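(* Let $(S,\mathcal{A},\mu)$ be a measure space and let $X$ be a Banach space. Then the following statements are equivalent: (i) The space $L_\infty(\mu,X)$ has the weak-DD2P. (ii) At least one of the following conditions holds: $\mu$ is not purely atomic, $\mu$ has infinitely many atoms, or $X$ has the weak-DD2P.
   Context: $L_\infty(\mu,X)$ is the usual Banach space of ($\mu$-a.e. classes of) strongly measurable essentially bounded functions $S\to X$ with the essential supremum norm. An atom of $\mu$ is a measurable set $A$ with $\mu(A)>0$ such that every measurable $B\subseteq A$ satisfies $\mu(B)=0$ or $\mu(A\setminus B)=0$; atoms are counted up to null sets; $\mu$ is purely atomic if every measurable set of positive measure contains an atom. A Banach space $Z$ (real or complex) with closed unit ball $B_Z$ has the weak-DD2P (weak diametral diameter two property) if for every non-empty relatively weakly open subset $W$ of $B_Z$ there exists $z\in W$ such that $\sup_{y\in V}\|z-y\|=2$ for every relatively weakly open subset $V$ of $B_Z$ with $z\in V$.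
   Formalization: The measure μ is assumed nonzero and X is assumed to be a nonzero Banach space; if μ = 0 or X = {0}, then L_∞(μ,X) = {0} fails the weak-DD2P although (ii) may hold. *)

(* Defs.v *)
From HB Require Import structures.
From mathcomp Require Import all_boot all_order all_algebra.
From mathcomp Require Import all_classical all_reals all_analysis.
From mathcomp Require Import ess_sup_inf complex.

Set Implicit Arguments.
Unset Strict Implicit.
Unset Printing Implicit Defensive.

Import Order.TTheory GRing.Theory Num.Theory.
Import numFieldNormedType.Exports.

Local Open Scope classical_set_scope.
Local Open Scope ring_scope.
Local Open Scope quotient_scope.

(* [scalar_field R K] witnesses that [K] is the field of real numbers [R] or
   the field of complex numbers [R[i]]. The norm of a [normedModType K] takes
   its values in [K]; [re] and [of_real] translate between these (nonnegative)
   elements of [K] and the real numbers. *)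
Variant scalar_field (R : realType) : numFieldType -> Type :=
  | RealScalars : scalar_field R R
  | ComplexScalars : scalar_field R (complex R).

Definition re (R : realType) (K : numFieldType) (sc : scalar_field R K) :
    K -> R :=
  match sc in scalar_field _ K return K -> R with
  | RealScalars => fun x => x
  | ComplexScalars => fun x => complex.Re x
  end.

Definition of_real (R : realType) (K : numFieldType) (sc : scalar_field R K) :
    R -> K :=
  match sc in scalar_field _ K return R -> K with
  | RealScalars => fun x => x
  | ComplexScalars => fun x => real_complex R x
  end.

Section scalar_field_lemmas.
Context (R : realType) (K : numFieldType) (sc : scalar_field R K).

Lemma of_realK : cancel (of_real sc) (re sc).
Proof. by case: sc. Qed.

Lemma of_real0 : of_real sc 0 = 0.
Proof. by case: sc. Qed.

Lemma of_realD : {morph of_real sc : x y / x + y}.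
Proof. by case: sc => // x y /=; rewrite rmorphD. Qed.

Lemma of_realM : {morph of_real sc : x y / x * y}.
Proof. by case: sc => // x y /=; rewrite rmorphM. Qed.

Lemma ler_of_real : {mono of_real sc : x y / x <= y}.
Proof. by case: sc => // x y /=; rewrite lecR. Qed.

Lemma ge0_reK (x : K) : 0 <= x -> of_real sc (re sc x) = x.
Proof.
case: sc x => //= -[a b]; rewrite lecE/= => /andP[/eqP b0 _].
by rewrite b0.
Qed.

Lemma ge0_ler_re (x : K) (r : R) :
  0 <= x -> (re sc x <= r) = (x <= of_real sc r).
Proof. by move=> x0; rewrite -ler_of_real ge0_reK. Qed.

End scalar_field_lemmas.

Section weak_DD2P.
Context (K : numFieldType) (Z : normedModType K).

Definition continuous_dual := {f : {linear Z -> K^o} | continuous f}.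

Definition weak_topological : topologicalType :=
  sup_topology (fun f : continuous_dual =>
    Topological.on (initial_topology (sval f : Z -> K^o))).

Definition weakly_open (U : set Z) : Prop := @open weak_topological U.

Definition closed_unit_ball : set Z := [set z | `|z| <= 1].

Definition relatively_weakly_open (W : set Z) : Prop :=
  exists2 U, weakly_open U & W = U `&` closed_unit_ball.

(* For complex scalars the supremum is taken for the partial order of the
   complex numbers, which on the norms is the usual order of the reals. *)
Definition weak_DD2P : Prop :=
  forall W, relatively_weakly_open W -> W !=set0 ->
    exists2 z, W z &
      forall V, relatively_weakly_open V -> V z ->
        supremums [set `|z - y| | y in V] 2.

End weak_DD2P.
Arguments weak_DD2P {K} Z.

Section atoms.
Context (R : realType) (d : measure_display) (S : measurableType d).
Variable mu : {measure set S -> \bar R}.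

Definition atom (A : set S) : Prop :=
  [/\ measurable A, (0 < mu A)%E &
      forall B, measurable B -> B `<=` A -> mu B = 0%E \/ mu (A `\` B) = 0%E].

Definition atom_class (A : set S) : set (set S) :=
  [set B | atom B /\ mu (A `+` B) = 0%E].

Definition infinitely_many_atoms : Prop :=
  infinite_set [set atom_class A | A in atom].

Definition purely_atomic : Prop :=
  forall B, measurable B -> (0 < mu B)%E -> exists2 A, atom A & A `<=` B.

End atoms.

Section strongly_measurable.
Context (R : realType) (K : numFieldType) (d : measure_display)
  (S : measurableType d) (mu : {measure set S -> \bar R})
  (X : normedModType K).
Implicit Types f g : S -> X.

(* The sets [f @^-1` [set x]] may have infinite measure. *)
Definition simple_function f : Prop :=
  finite_set (range f) /\ forall x, measurable (f @^-1` [set x]).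

Definition strongly_measurable f : Prop :=
  exists g : nat -> S -> X, (forall n, simple_function (g n)) /\
    {ae mu, forall x, g ^~ x @ \oo --> f x}.

Definition essentially_bounded f : Prop :=
  exists M : K, {ae mu, forall x, `|f x| <= M}.

Lemma simple_function_lin (a : K) f g :
  simple_function f -> simple_function g -> simple_function (a *: f + g).
Proof.
move=> [Ff mf] [Fg mg]; split.
  apply: (@sub_finite_set _ _
    [set a *: u + v | u in range f & v in range g]).
    by move=> _ [x _ <-]; exists (f x) => //; exists (g x).
  exact: finite_image2.
move=> y.
rewrite (_ : _ @^-1` _ = \bigcup_(u in range f)
    (f @^-1` [set u] `&` g @^-1` [set y - a *: u])).
  apply: fin_bigcup_measurable => // u _.
  exact: measurableI.
apply/seteqP; split=> [x /= <-|x [u _ [/= <- gx]]]; last first.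
  by rewrite !fctE gx addrC subrK.
by exists (f x) => //; split=> //=; rewrite !fctE addrC addrK.
Qed.

Lemma strongly_measurable_lin (a : K) f g :
  strongly_measurable f -> strongly_measurable g ->
  strongly_measurable (a *: f + g).
Proof.
move=> [u [su uf]] [v [sv vg]].
exists (fun n => a *: u n + v n); split.
  by move=> n; exact: simple_function_lin.
apply: filterS2 uf vg => x ux vx.
by apply: cvgD => //; exact: cvgZl_tmp.
Qed.

Lemma simple_function0 : simple_function (0 : S -> X).
Proof.
split; first by apply: (@sub_finite_set _ _ [set 0]) => // _ [x _ <-].
move=> y; have [->|y0] := eqVneq y 0.
  by rewrite (_ : _ @^-1` _ = setT)//; apply/seteqP; split.
rewrite (_ : _ @^-1` _ = set0)//; apply/seteqP; split=> // x /= y0'.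
by move: y0; rewrite -y0' eqxx.
Qed.

Lemma strongly_measurable0 : strongly_measurable (0 : S -> X).
Proof.
exists (fun=> 0); split; first by move=> _; exact: simple_function0.
by apply: nearW => x; exact: cvg_cst.
Qed.

Lemma essentially_bounded_lin (a : K) f g :
  essentially_bounded f -> essentially_bounded g ->
  essentially_bounded (a *: f + g).
Proof.
move=> [M fM] [N gN]; exists (`|a| * M + N).
apply: filterS2 fM gN => x fx gx.
rewrite fctE/= (le_trans (ler_normD _ _))// lerD// normrZ.
by rewrite ler_wpM2l.
Qed.

Lemma essentially_bounded0 : essentially_bounded (0 : S -> X).
Proof. by exists 0; apply: nearW => x; rewrite normr0. Qed.

End strongly_measurable.

Section Linfty_fun.
Context (R : realType) (K : numFieldType) (d : measure_display)
  (S : measurableType d) (mu : {measure set S -> \bar R})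
  (X : normedModType K).

Definition Linfty_pred : {pred S -> X} :=
  fun f => `[< strongly_measurable mu f /\ essentially_bounded mu f >].

Lemma Linfty_predP (f : S -> X) :
  reflect (strongly_measurable mu f /\ essentially_bounded mu f)
    (f \in Linfty_pred).
Proof. exact: asboolP. Qed.

Lemma Linfty_pred_submod_closed : submod_closed Linfty_pred.
Proof.
split.
  apply/Linfty_predP; split; first exact: strongly_measurable0.
  exact: essentially_bounded0.
move=> a f g /Linfty_predP[mf bf] /Linfty_predP[mg bg].
apply/Linfty_predP; split; first exact: strongly_measurable_lin.
exact: essentially_bounded_lin.
Qed.

HB.instance Definition _ :=
  GRing.isSubmodClosed.Build K (S -> X) Linfty_pred Linfty_pred_submod_closed.

Definition Linfty_fun : Type := {f : S -> X | f \in Linfty_pred}.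

HB.instance Definition _ := SubType.on Linfty_fun.
HB.instance Definition _ := Choice.on Linfty_fun.
HB.instance Definition _ := [SubChoice_isSubLmodule of Linfty_fun by <:].

Definition Linfty_null : {pred Linfty_fun} :=
  fun f => `[< {ae mu, forall x, \val f x = 0} >].

Lemma Linfty_nullP (f : Linfty_fun) :
  reflect {ae mu, forall x, \val f x = 0} (f \in Linfty_null).
Proof. exact: asboolP. Qed.

Lemma Linfty_null_submod_closed : submod_closed Linfty_null.
Proof.
split; first by apply/Linfty_nullP; apply: nearW.
move=> a f g /Linfty_nullP f0 /Linfty_nullP g0; apply/Linfty_nullP.
apply: filterS2 f0 g0 => x fx gx.
by rewrite linearP/= !fctE fx gx scaler0 addr0.
Qed.

HB.instance Definition _ :=
  GRing.isSubmodClosed.Build K Linfty_fun Linfty_null Linfty_null_submod_closed.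

End Linfty_fun.

(* The scalar-field witness only serves to define the norm. *)
Definition Linfty (R : realType) (K : numFieldType) (sc : scalar_field R K)
    (d : measure_display) (S : measurableType d)
    (mu : {measure set S -> \bar R}) (X : normedModType K) : Type :=
  Quotient.quot (@Linfty_null R K d S mu X).

Section Linfty_normed.
Context (R : realType) (K : numFieldType) (sc : scalar_field R K)
  (d : measure_display) (S : measurableType d)
  (mu : {measure set S -> \bar R}) (X : normedModType K).
Local Notation L := (Linfty sc mu X).
Local Notation LF := (Linfty_fun mu X).

HB.instance Definition _ := Choice.on L.
HB.instance Definition _ := EqQuotient.on L.
HB.instance Definition _ := GRing.Zmodule.on L.
HB.instance Definition _ := ZmodQuotient.on L.

Lemma Linfty_eqP (f g : LF) :
  \pi_L f = \pi_L g <-> {ae mu, forall x, \val f x = \val g x}.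
Proof.
have -> : (\pi_L f = \pi_L g) <-> (f - g \in @Linfty_null R K d S mu X).
  by rewrite Quotient.idealrBE; split=> /eqP.
split=> [/Linfty_nullP|] fg; last apply/Linfty_nullP;
  apply: filterS fg => x.
  by move=> /eqP; rewrite raddfB/= !fctE subr_eq0 => /eqP.
by move=> fg; rewrite raddfB/= !fctE fg subrr.
Qed.

Definition Linfty_scale (a : K) (u : L) : L := \pi_L (a *: repr u).

Lemma Linfty_scale_pi (a : K) (f : LF) :
  Linfty_scale a (\pi_L f) = \pi_L (a *: f).
Proof.
apply/Linfty_eqP.
have /Linfty_eqP : \pi_L (repr (\pi_L f)) = \pi_L f by rewrite reprK.
by apply: filterS => x fx; rewrite !linearZ/= !fctE fx.
Qed.

Lemma Linfty_scaleA (a b : K) (u : L) :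
  Linfty_scale a (Linfty_scale b u) = Linfty_scale (a * b) u.
Proof.
elim/quotW: u => f.
rewrite (Linfty_scale_pi b f) (Linfty_scale_pi a).
by rewrite (Linfty_scale_pi (a * b)) scalerA.
Qed.

Lemma Linfty_scale1 : left_id 1 Linfty_scale.
Proof. by elim/quotW => f; rewrite (Linfty_scale_pi 1 f) scale1r. Qed.

Lemma Linfty_scaleDr : right_distributive Linfty_scale +%R.
Proof.
move=> a; elim/quotW => f; elim/quotW => g.
rewrite -raddfD (Linfty_scale_pi a (f + g)) (Linfty_scale_pi a f).
by rewrite (Linfty_scale_pi a g) scalerDr raddfD.
Qed.

Lemma Linfty_scaleDl (u : L) :
  {morph Linfty_scale^~ u : a b / a + b}.
Proof.
elim/quotW: u => f a b.
rewrite (Linfty_scale_pi (a + b) f) (Linfty_scale_pi a f).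
by rewrite (Linfty_scale_pi b f) scalerDl raddfD.
Qed.

HB.instance Definition _ := GRing.Zmodule_isLmodule.Build K L
  Linfty_scaleA Linfty_scale1 Linfty_scaleDr Linfty_scaleDl.

(* When [mu] is the zero measure the essential supremum is [-oo], and the
   value of [fine] is then [0]. *)
Definition ess_norm (f : S -> X) : R :=
  fine (ess_sup mu (fun x => (re sc `|f x|)%:E)).

Definition Linfty_norm (u : L) : K := of_real sc (ess_norm (\val (repr u))).

Lemma eq_ess_norm (f g : S -> X) :
  {ae mu, forall x, f x = g x} -> ess_norm f = ess_norm g.
Proof.
by move=> fg; congr fine; apply: eq_ess_sup; apply: filterS fg => x ->.
Qed.

Lemma Linfty_norm_pi (f : LF) :
  Linfty_norm (\pi_L f) = of_real sc (ess_norm (\val f)).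
Proof.
by congr (of_real sc _); apply: eq_ess_norm; apply/Linfty_eqP; rewrite reprK.
Qed.

Lemma ess_norm_ge0 (f : S -> X) : 0 <= ess_norm f.
Proof.
rewrite /ess_norm.
have re0 x : (0 <= re sc `|f x|)%R.
  by rewrite -(ler_of_real sc) of_real0 ge0_reK.
have [mu0|mu0] := ltP 0%E (mu setT).
  by apply: fine_ge0; apply: ess_sup_gee => //; apply: nearW.
rewrite [ess_sup _ _](_ : _ = -oo%E)//; apply/ess_sup_eqNyP.
exists setT; split => //.
by apply/eqP; rewrite -measure_le0.
Qed.

Lemma ess_norm_le (f : S -> X) (M : R) : 0 <= M ->
  {ae mu, forall x, `|f x| <= of_real sc M} -> ess_norm f <= M.
Proof.
move=> M0 fM.
have : (ess_sup mu (fun x => (re sc `|f x|)%:E) <= M%:E)%E.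
  apply/ess_supP; apply: filterS fM => x.
  by rewrite lee_fin ge0_ler_re.
by rewrite /ess_norm; case: ess_sup.
Qed.

Lemma ae_le_ess_norm (f : S -> X) : essentially_bounded mu f ->
  {ae mu, forall x, `|f x| <= of_real sc (ess_norm f)}.
Proof.
move=> [M fM]; set s := ess_sup mu (fun x => (re sc `|f x|)%:E).
have fs := ess_sup_ge mu (fun x => (re sc `|f x|)%:E).
have sM : (s <= (re sc `|M|)%:E)%E.
  apply/ess_supP; apply: filterS fM => x fx.
  rewrite lee_fin ge0_ler_re// ge0_reK// ger0_norm//.
  exact: le_trans fx.
apply: filterS fs => x; rewrite -ge0_ler_re// /ess_norm -/s.
by case: s sM => //= r; rewrite lee_fin.
Qed.

Lemma ess_norm_bounded (u : L) : essentially_bounded mu (\val (repr u)).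
Proof. by have /Linfty_predP[] := valP (repr u). Qed.

Lemma Linfty_ler_normD (u v : L) :
  Linfty_norm (u + v) <= Linfty_norm u + Linfty_norm v.
Proof.
rewrite -[in leLHS](reprK u) -[in leLHS](reprK v) -raddfD Linfty_norm_pi.
rewrite /Linfty_norm -of_realD ler_of_real.
apply: ess_norm_le; first by rewrite addr_ge0// ess_norm_ge0.
apply: filterS2 (ae_le_ess_norm (ess_norm_bounded u))
  (ae_le_ess_norm (ess_norm_bounded v)) => x ux vx.
by rewrite of_realD (le_trans (ler_normD _ _))// lerD.
Qed.

Lemma Linfty_norm0_eq0 (u : L) : Linfty_norm u = 0 -> u = 0.
Proof.
move=> u0; rewrite -[u]reprK -[RHS](raddf0 \pi_L); apply/Linfty_eqP.
apply: filterS (ae_le_ess_norm (ess_norm_bounded u)) => x.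
by rewrite -/(Linfty_norm u) u0 normr_le0 => /eqP.
Qed.

Lemma Linfty_normZ_le (a : K) (u : L) :
  Linfty_norm (a *: u) <= `|a| * Linfty_norm u.
Proof.
rewrite -[in leLHS](reprK u) [_ *: _]Linfty_scale_pi Linfty_norm_pi.
rewrite /Linfty_norm -[X in X * _](ge0_reK sc)// -of_realM ler_of_real.
apply: ess_norm_le.
  rewrite mulr_ge0 ?ess_norm_ge0//.
  by rewrite -(ler_of_real sc) of_real0 ge0_reK.
apply: filterS (ae_le_ess_norm (ess_norm_bounded u)) => x ux.
by rewrite of_realM ge0_reK// normrZ ler_wpM2l.
Qed.

Lemma Linfty_normZ (a : K) (u : L) :
  Linfty_norm (a *: u) = `|a| * Linfty_norm u.
Proof.
apply/eqP; rewrite eq_le Linfty_normZ_le/=.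
have [->|a0] := eqVneq a 0.
  rewrite normr0 mul0r /Linfty_norm -(of_real0 sc) ler_of_real.
  exact: ess_norm_ge0.
rewrite -ler_pdivlMl ?normr_gt0//.
have /= := Linfty_normZ_le a^-1 (a *: u).
by rewrite scalerA mulVf// scale1r normfV.
Qed.

HB.instance Definition _ := Lmodule_isNormed.Build K L
  Linfty_ler_normD Linfty_normZ Linfty_norm0_eq0.

Lemma Linfty_normE (f : LF) : `|\pi_L f| = of_real sc (ess_norm (\val f)).
Proof. exact: Linfty_norm_pi. Qed.

End Linfty_normed.

(* Main.v *)
From HB Require Import structures.
Require Import Defs.
From mathcomp Require Import all_boot all_order all_algebra.
From mathcomp Require Import all_classical all_reals all_analysis.

Import Order.TTheory GRing.Theory Num.Theory.
Import numFieldNormedType.Exports.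

Local Open Scope classical_set_scope.
Local Open Scope ring_scope.

(** Two mechanisms decide whether [L_oo(mu, X)] has the weak-DD2P.

    Suppose first that there is a sequence of pairwise disjoint sets of
    positive measure. One exists when [mu] is not purely atomic, for a set
    without atoms can be split forever ([not_purely_atomic_disjoint]), and when
    [mu] has infinitely many atoms, for inequivalent atoms overlap in null sets
    ([infinitely_many_atoms_disjoint]). If a function [g] is overwritten by [f]
    on the [n]-th set, the results converge weakly to [g]
    ([splice_weak_cvg]): their differences to [g] are disjointly supported,
    hence add up, with any coefficients of modulus at most 1, to a function of
    norm at most [|f - g|]. Fix a unit vector [x] and group the sets into
    infinitely many infinite families. A weakly open set around a function in
    the unit ball then contains a function [z] equal to [x] on the union of a
    whole family, and weakly close to [z] there are functions equal to [- x] on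
    one member of that family, at distance 2 from [z]
    ([disjoint_weak_DD2P]).

    Otherwise [mu] is carried by finitely many atoms
    ([finitely_many_atoms_cover]). A strongly measurable function is a.e.
    constant on an atom ([strongly_measurable_atom]), so each atom contributes
    to [L_oo(mu, X)] a summand [X] in the sense of [l_oo]-sums. If [X] has the
    weak-DD2P, so has every such sum, since a function may be varied on one
    atom and kept fixed elsewhere ([weak_DD2P_Linfty_of_atom]). If [X] lacks it
    because of a set [W], consider the functions all of whose values are in
    [W]: around the values of such a function the suprema in [X] are less than
    2, and the supremum around the function is at most their maximum, which is
    less than 2 because there are finitely many atoms
    ([weak_DD2P_of_Linfty]). *)

(** * Weak topologies *)

Section weak_topology.
Context {K : numFieldType}.
Implicit Types Y Z : normedModType K.

Lemma functional_weakly_continuous Z (phi : continuous_dual Z) :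
  continuous (sval phi : weak_topological Z -> K^o).
Proof.
move=> z A Anb.
have /cvg_sup/(_ phi) :
    nbhs (z : weak_topological Z) --> (z : weak_topological Z) by exact: cvg_id.
apply; exact: (@initial_continuous Z K^o (sval phi) z A Anb).
Qed.

(** Weak convergence is convergence against every functional; stated for an
    arbitrary filter, it serves both weakly convergent sequences and the weak
    continuity of affine maps. *)
Lemma weakly_open_cvg Z (U : set Z) (z : Z) (F : set_system Z) {FF : Filter F} :
  weakly_open U -> U z ->
  (forall phi : continuous_dual Z, sval phi x @[x --> F] --> sval phi z) ->
  F U.
Proof.
move=> oU Uz Fz.
suff Fw : F --> (z : weak_topological Z).
  apply: Fw; exact: (@open_nbhs_nbhs (weak_topological Z)).
apply/cvg_sup => phi U' [?/= [[W oW <-]]] /= Wsfz /filterS; apply.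
apply: (Fz phi).
exact: open_nbhs_nbhs.
Qed.

(** Composing a functional with a continuous affine map gives a functional up
    to a constant, so norm continuity implies weak-to-weak continuity. *)
Lemma weakly_open_preimage_affine Y Z (T : {linear Y -> Z}) (b : Z)
    (U : set Z) :
  continuous T -> weakly_open U -> weakly_open ((fun y => b + T y) @^-1` U).
Proof.
move=> cT oU; rewrite /weakly_open openE => y /= Uy.
apply: (@weakly_open_cvg Z U (b + T y)
  ((fun x : weak_topological Y => b + T x) @ nbhs (y : weak_topological Y)))
  => //.
move=> phi.
have cphiT : continuous (sval phi \o T : Y -> K^o).
  by move=> x; apply: continuous_comp; [exact: cT|exact: (svalP phi)].
pose psi : continuous_dual Y :=
  exist _ (sval phi \o T : {linear Y -> K^o}) cphiT.
suff : ((fun x => sval phi (b + T x)) : weak_topological Y -> K^o)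
    @ nbhs (y : weak_topological Y) --> sval phi (b + T y) by [].
rewrite (_ : (fun x => _) = (fun x => sval phi b + sval psi x)); last first.
  by apply/funext => x; rewrite linearD.
rewrite linearD.
apply: (@cvgD K K^o (weak_topological Y) (nbhs (y : weak_topological Y)) _
  (fun=> sval phi b) (sval psi)).
  exact: cvg_cst.
exact: (functional_weakly_continuous Y psi).
Qed.

End weak_topology.

Local Open Scope quotient_scope.

(** * Overwriting functions on measurable sets *)

Lemma ltr_of_real {R : realType} {K : numFieldType} (sc : scalar_field R K) :
  {mono of_real sc : x y / x < y}.
Proof. by apply: leW_mono; exact: ler_of_real. Qed.

Lemma of_real_nat {R : realType} {K : numFieldType} (sc : scalar_field R K)
  (n : nat) : of_real sc n%:R = n%:R.
Proof.
elim: n => [|n IHn]; first exact: of_real0.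
by rewrite !mulrS of_realD IHn; congr (_ + _); case: sc {IHn}.
Qed.

Section Linfty_tools.
Context {R : realType} {K : numFieldType} (sc : scalar_field R K)
  {d : measure_display} {S : measurableType d}
  (mu : {measure set S -> \bar R}) (X : normedModType K).
Local Notation L := (Linfty sc mu X).
Local Notation LF := (Linfty_fun mu X).

Lemma val_LinftyD (f g : LF) t : \val (f + g) t = \val f t + \val g t.
Proof. by rewrite raddfD. Qed.

Lemma val_LinftyB (f g : LF) t : \val (f - g) t = \val f t - \val g t.
Proof. by rewrite raddfB. Qed.

Lemma val_LinftyZ (a : K) (f : LF) t : \val (a *: f) t = a *: \val f t.
Proof. by rewrite linearZ. Qed.

Lemma Linfty_piZ (a : K) (f : LF) : \pi_L (a *: f) = a *: \pi_L f.
Proof. exact/esym/Linfty_scale_pi. Qed.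

Lemma Linfty_norm_le (f : LF) (M : K) : 0 <= M ->
  {ae mu, forall t, `|\val f t| <= M} -> `|\pi_L f| <= M.
Proof.
move=> M0; rewrite -(ge0_reK sc M0) => fM; rewrite Linfty_normE ler_of_real.
by apply: ess_norm_le => //; rewrite -(ler_of_real sc) of_real0 ge0_reK.
Qed.

Lemma ae_le_Linfty_norm (f : LF) : {ae mu, forall t, `|\val f t| <= `|\pi_L f|}.
Proof.
rewrite Linfty_normE; apply: ae_le_ess_norm.
by have /Linfty_predP[] := valP f.
Qed.

Lemma simple_function_patch (A : set S) (f g : S -> X) :
  measurable A -> simple_function f -> simple_function g ->
  simple_function (patch g A f).
Proof.
move=> mA [Ff mf] [Fg mg]; split.
  apply: (@sub_finite_set _ _ (range f `|` range g)).
    move=> _ [t _ <-]; rewrite /patch.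
    by case: ifPn => _; [left|right]; exact: imageT.
  by rewrite finite_setU.
move=> x.
rewrite (_ : _ @^-1` _ =
    (A `&` f @^-1` [set x]) `|` (~` A `&` g @^-1` [set x])).
  by apply: measurableU; apply: measurableI => //; exact: measurableC.
apply/seteqP; split => t /=; rewrite /patch.
  case: ifPn => [/set_mem At <-|/negP At <-]; first by left.
  by right; split=> // /mem_set.
by case=> -[At <-]; [rewrite mem_set|rewrite memNset].
Qed.

Lemma strongly_measurable_patch (A : set S) (f g : S -> X) :
  measurable A -> strongly_measurable mu f -> strongly_measurable mu g ->
  strongly_measurable mu (patch g A f).
Proof.
move=> mA [u [su uf]] [v [sv vg]].
exists (fun n => patch (v n) A (u n)); split.
  by move=> n; exact: simple_function_patch.
by apply: filterS2 uf vg => t ut vt; rewrite /patch; case: ifPn.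
Qed.

Lemma patch_Linfty (A : set S) (f g : LF) : measurable A ->
  patch (\val g) A (\val f) \in @Linfty_pred R K d S mu X.
Proof.
move=> mA.
have /Linfty_predP[mf [M fM]] := valP f.
have /Linfty_predP[mg [N gN]] := valP g.
apply/Linfty_predP; split; first exact: strongly_measurable_patch.
exists (`|M| + `|N|); apply: filterS2 fM gN => t ft gt.
rewrite /patch; case: ifPn => _.
  by rewrite (le_trans ft)// ler_wpDr// ger0_norm// (le_trans _ ft).
by rewrite (le_trans gt)// ler_wpDl// ger0_norm// (le_trans _ gt).
Qed.

Definition splice {A : set S} (mA : measurable A) (f g : LF) : LF :=
  Sub (patch (\val g) A (\val f)) (patch_Linfty A f g mA).

Lemma cst_Linfty (x : X) : cst x \in @Linfty_pred R K d S mu X.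
Proof.
apply/Linfty_predP; split; last by exists `|x|; exact: nearW.
exists (fun=> cst x); split; last by apply: nearW => t; exact: cvg_cst.
move=> _; split.
  by apply: (@sub_finite_set _ _ [set x]) => // _ [t _ <-].
by move=> y; rewrite preimage_cst; case: ifP.
Qed.

Definition Linfty_cst (x : X) : LF := Sub (cst x) (cst_Linfty x).

Lemma splice_in (A : set S) (mA : measurable A) (f g : LF) t :
  A t -> \val (splice mA f g) t = \val f t.
Proof. by move=> At; rewrite SubK /patch mem_set. Qed.

Lemma splice_out (A : set S) (mA : measurable A) (f g : LF) t :
  ~ A t -> \val (splice mA f g) t = \val g t.
Proof. by move=> At; rewrite SubK /patch memNset. Qed.

Lemma splice_norm_le (A : set S) (mA : measurable A) (f g : LF) (M : K) :
  `|\pi_L f| <= M -> `|\pi_L g| <= M -> `|\pi_L (splice mA f g)| <= M.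
Proof.
move=> fM gM; apply: Linfty_norm_le; first exact: le_trans fM.
apply: filterS2 (ae_le_Linfty_norm f) (ae_le_Linfty_norm g) => t ft gt.
have [At|At] := pselect (A t).
  by rewrite splice_in// (le_trans ft).
by rewrite splice_out// (le_trans gt).
Qed.

Lemma Linfty_cst_norm (x : X) : `|\pi_L (Linfty_cst x)| <= `|x|.
Proof. by apply: Linfty_norm_le => //; exact: nearW. Qed.

Lemma continuous_dual_bounded (Z : normedModType K) (phi : continuous_dual Z) :
  exists2 k : K, 0 < k & forall z, `|sval phi z| <= k * `|z|.
Proof.
by have /linear_bounded_continuous/linear_boundedP/pinfty_ex_gt0 := svalP phi.
Qed.

(** At each point at most one summand is nonzero, so the bound does not depend
    on the number of terms. *)
Lemma norm_splice_sum_le (A : nat -> set S) (mA : forall n, measurable (A n))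
    (h : LF) (c : nat -> K) (N : nat) : trivIset setT A ->
  (forall n, `|c n| <= 1) ->
  `|\pi_L (\sum_(n < N) c n *: splice (mA n) h 0)| <= `|\pi_L h|.
Proof.
move=> tA c1; apply: Linfty_norm_le => //.
apply: filterS (ae_le_Linfty_norm h) => t ht.
rewrite raddf_sum fct_sumE.
rewrite (eq_bigr (fun n : 'I_N => c n *: val (splice (mA n) h 0) t));
  last by move=> n _; exact: val_LinftyZ.
have [[k [kN Akt]]|nA] := pselect (exists k, (k < N)%N /\ A k t).
  rewrite (bigD1 (Ordinal kN))// big1 => [|j /eqP jk].
    by rewrite [X in `|X|]addr0 splice_in// normrZ (le_trans _ ht)// ler_piMl.
  rewrite splice_out ?scaler0// => Ajt; apply: jk; apply: val_inj.
  by apply: tA => //; exists t.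
rewrite big1 ?normr0// => j _.
by rewrite splice_out ?scaler0// => Ajt; apply: nA; exists j.
Qed.

(** A functional [phi] takes on the differences to [g] values with summable
    moduli: multiplied by suitable coefficients of modulus at most 1 these
    moduli become the value of [phi] at one sum, which is bounded by
    [norm_splice_sum_le]. In particular they tend to 0. *)
Lemma splice_weak_cvg (A : nat -> set S) (mA : forall n, measurable (A n))
    (f g : LF) (phi : continuous_dual L) : trivIset setT A ->
  sval phi (\pi_L (splice (mA n) f g)) @[n --> \oo] --> sval phi (\pi_L g).
Proof.
move=> tA.
pose u n : L := \pi_L (splice (mA n) (f - g) 0).
have uE n : \pi_L (splice (mA n) f g) = \pi_L g + u n.
  rewrite /u -raddfD; congr (\pi_L _); apply: val_inj; apply/funext => t.
  rewrite val_LinftyD; have [At|At] := pselect (A n t).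
    by rewrite !splice_in// val_LinftyB addrC subrK.
  by rewrite !splice_out// addr0.
have [k k0 phik] := continuous_dual_bounded _ phi.
pose C := k * `|\pi_L (f - g) : L|.
have C0 : 0 <= C by rewrite mulr_ge0// ltW.
pose a n := re sc `|sval phi (u n)|.
have aE n : of_real sc (a n) = `|sval phi (u n)| by rewrite ge0_reK.
have a0 n : 0 <= a n by rewrite -(ler_of_real sc) of_real0 aE.
have sumC N : \sum_(n < N) a n <= re sc C.
  rewrite -(ler_of_real sc) ge0_reK//.
  rewrite (big_morph _ (of_realD sc) (of_real0 sc)).
  (* The coefficient that rotates [phi (u n)] onto its modulus. *)
  pose c n : K :=
    if sval phi (u n) == 0 then 0 else `|sval phi (u n)| / sval phi (u n).
  have c1 n : `|c n| <= 1.
    rewrite /c; case: ifPn => [_|phi0]; first by rewrite normr0.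
    by rewrite normrM normfV normr_id divff// normr_eq0.
  have sumE : \sum_(n < N) of_real sc (a n) =
      sval phi (\pi_L (\sum_(n < N) c n *: splice (mA n) (f - g) 0)).
    rewrite !raddf_sum; apply: eq_bigr => n _; rewrite aE.
    transitivity (sval phi (c n *: u n)).
      rewrite linearZ/= /c; case: ifPn => [/eqP ->|phi0].
        by rewrite normr0 scaler0.
      by rewrite [RHS]divfK.
    by congr (sval phi _); exact: Linfty_scale_pi.
  have : 0 <= \sum_(n < N) of_real sc (a n).
    by apply: sumr_ge0 => n _; rewrite aE.
  rewrite sumE => /ger0_norm <-.
  apply: le_trans (phik _) _.
  by rewrite ler_pM2l// norm_splice_sum_le.
have a_cvg : a n @[n --> \oo] --> 0.
  apply: cvg_series_cvg_0; apply: nondecreasing_is_cvgn.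
    by apply: nondecreasing_series => n _ _.
  by exists (re sc C) => _ [N _ <-]; rewrite /series/= big_mkord.
rewrite (_ : (fun n => _) =
    (fun=> sval phi (\pi_L g)) + (fun n => sval phi (u n))).
  suff phiu0 : sval phi (u n) @[n --> \oo] --> 0.
    rewrite -[in X in _ --> X](addr0 (sval phi (\pi_L g))).
    by apply: cvgD => //; exact: cvg_cst.
  apply/cvgr0Pnorm_lt => e e0.
  have e0' : 0 < re sc e by rewrite -(ltr_of_real sc) of_real0 ge0_reK// ltW.
  move/cvgr0Pnorm_lt : a_cvg => /(_ _ e0'); apply: filterS => n.
  by rewrite ger0_norm// -(ltr_of_real sc) aE ge0_reK// ltW.
by apply/funext => n; rewrite /= uE linearD.
Qed.

End Linfty_tools.

(** The unit ball has diameter at most 2, so only the lower estimate of the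
    supremum has content. *)
Lemma diametral_supP {K : numFieldType} {Z : normedModType K} (V : set Z)
    (z : Z) :
  relatively_weakly_open V -> V z ->
  (supremums [set `|z - y| | y in V] 2 <->
   forall c, ubound [set `|z - y| | y in V] c -> 2 <= c).
Proof.
move=> [U _ ->] [_ /= z1]; split=> [[_ lub]|lub]; first by move=> c /lub.
split=> // _ [y [_ /= y1] <-].
by rewrite (le_trans (ler_normB _ _))// -[2]/(1 + 1) lerD.
Qed.

(** * Disjoint sequences of sets of positive measure *)

Section disjoint_sequences.
Context {R : realType} {d : measure_display} {S : measurableType d}
  (mu : {measure set S -> \bar R}).

Lemma ae_meets (A : set S) (P : S -> Prop) : measurable A -> mu A <> 0%E ->
  {ae mu, forall t, P t} -> exists2 t, A t & P t.
Proof.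
move=> mA A0 aP; apply: contrapT => nP; apply: A0.
apply: measure_negligible => //; apply: negligibleS aP => t At /= Pt.
by apply: nP; exists t.
Qed.

(** In a set [B] without atoms, every measurable part [C] of positive measure
    contains some [D C] such that [D C] and [C `\` D C] have positive measure.
    Cutting off such pieces one after the other yields the sequence. *)
Lemma not_purely_atomic_disjoint : ~ purely_atomic mu ->
  exists A : nat -> set S, [/\ forall n, measurable (A n),
    trivIset setT A & forall n, mu (A n) <> 0%E].
Proof.
rewrite /purely_atomic.
move=> /existsNP[B /not_implyP[mB /not_implyP[B0 noatom]]].
pose good C := [/\ measurable C, C `<=` B & mu C <> 0%E].
pose splits C D :=
  [/\ measurable D, D `<=` C, mu D <> 0%E & mu (C `\` D) <> 0%E].
have split_ex C : exists D, good C -> splits C D.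
  have [[mC CB C0]|?] := pselect (good C); last by exists set0.
  apply: contrapT => nD; apply: noatom; exists C => //; split=> //.
    by rewrite lt0e; apply/andP; split=> //; apply/eqP.
  move=> D mD DC; have [D0|D0] := pselect (mu D = 0%E); first by left.
  have [CD0|CD0] := pselect (mu (C `\` D) = 0%E); first by right.
  by exfalso; apply: nD; exists D.
have [D DP] := choice split_ex.
pose C n := iter n (fun C => C `\` D C) B.
have goodC n : good (C n).
  elim: n => [|n IHn]; first by split=> //; apply/eqP; rewrite gt_eqF.
  have [mD DC D0 CD0] := DP _ IHn; have [mC CB _] := IHn; split => //=.
    exact: measurableD.
  by move=> t [/CB].
have Cle m n : (m <= n)%N -> C n `<=` C m.
  move=> /subnK <-; elim: (n - m)%N => // k IHk t [Ct _].
  by apply: IHk.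
exists (fun n => D (C n)); split=> [n| |n].
- by have [] := DP _ (goodC n).
- apply: ltn_trivIset => n m mn; apply/seteqP; split=> // t [Dm Dn].
  have [_ DC _ _] := DP _ (goodC n).
  by have [] := Cle _ _ mn t (DC _ Dn).
- by have [] := DP _ (goodC n).
Qed.

Lemma atom_class_eq (A B : set S) : measurable A -> measurable B ->
  mu (A `+` B) = 0%E -> atom_class mu A = atom_class mu B.
Proof.
have mY (C D : set S) : measurable C -> measurable D -> measurable (C `+` D).
  by move=> mC mD; apply: measurableU; exact: measurableD.
suff sub (C D : set S) : measurable C -> measurable D -> mu (C `+` D) = 0%E ->
    atom_class mu C `<=` atom_class mu D.
  move=> mA mB AB0; apply/seteqP; split; apply: sub => //.
  by rewrite setYC.
move=> mC mD /(negligibleP mu (mY _ _ mC mD)) CD0 E [aE]; have [mE _ _] := aE.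
move=> /(negligibleP mu (mY _ _ mC mE)) CE0; split=> //.
apply: measure_negligible; first exact: mY.
apply: negligibleS (negligibleU CD0 CE0) => t [[Dt Et]|[Et Dt]].
  by have [Ct|Ct] := pselect (C t); [right; left|left; right].
by have [Ct|Ct] := pselect (C t); [left; left|right; right].
Qed.

(** If the intersection is not null, each atom is contained in the other one up
    to a null set. *)
Lemma atom_inter_null (A B : set S) : atom mu A -> atom mu B ->
  atom_class mu A <> atom_class mu B -> mu (A `&` B) = 0%E.
Proof.
move=> [mA A0 aA] [mB B0 aB] AB.
have mAB := measurableI _ _ mA mB.
have [//|AB0] := aA _ mAB (@subIsetl _ A B).
have [//|BA0] := aB _ mAB (@subIsetr _ A B).
exfalso; apply: AB; apply: atom_class_eq => //.
apply: measure_negligible.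
  by apply: measurableU; exact: measurableD.
suff : mu.-negligible ((A `\` (A `&` B)) `|` (B `\` (A `&` B))).
  by apply: negligibleS => t [[At Bt]|[Bt At]]; [left|right]; split=> // -[].
by apply: negligibleU; apply/negligibleP => //; exact: measurableD.
Qed.

(** Atoms from different classes are disjoint up to null sets; removing from
    each one its predecessors does not change its measure. *)
Lemma infinitely_many_atoms_disjoint : infinitely_many_atoms mu ->
  exists A : nat -> set S, [/\ forall n, measurable (A n),
    trivIset setT A & forall n, mu (A n) <> 0%E].
Proof.
move=> /infiniteP/pcard_leP[g].
have gA n : exists A, atom mu A /\ atom_class mu A = g n.
  have [A aA <-] : [set atom_class mu A | A in atom mu] (g n) by exact: funS.
  by exists A.
have [A /all_and2[aA Ag]] := choice gA.
have mA n : measurable (A n) by have [] := aA n.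
have meet0 m n : m <> n -> mu (A m `&` A n) = 0%E.
  move=> mn; apply: atom_inter_null => //.
  by rewrite !Ag => /inj; rewrite !inE => /(_ I I).
exists (seqDU A); split; first exact: seqDU_measurable.
  exact: trivIset_seqDU.
move=> n An0; have [_ + _] := aA n; apply/negP; rewrite -leNgt.
rewrite measure_le0; apply/eqP; apply: measure_negligible => //.
suff : mu.-negligible (seqDU A n `|`
    \bigcup_m (if m == n then set0 else A m `&` A n)).
  apply: negligibleS => t Ant.
  have [t_lt|t_lt] := pselect ((\big[setU/set0]_(m < n) A m) t).
    move: t_lt; rewrite -bigcup_mkord => -[m /= mn Amt]; right; exists m => //.
    by rewrite ltn_eqF.
  by left; split.
apply: negligibleU; first by apply/negligibleP => //; exact: seqDU_measurable.
apply: negligible_bigcup => m; case: eqP => [_|mn].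
  exact: negligible_set0.
by apply/negligibleP; [exact: measurableI|exact: meet0].
Qed.

End disjoint_sequences.

Section disjoint_weak_DD2P.
Context {R : realType} {K : numFieldType} (sc : scalar_field R K)
  {d : measure_display} {S : measurableType d}
  (mu : {measure set S -> \bar R}) (X : normedModType K).
Local Notation L := (Linfty sc mu X).
Local Notation LF := (Linfty_fun mu X).
Local Notation splice := (splice mu X).
Local Notation Linfty_cst := (Linfty_cst mu X).

Lemma Linfty_norm_ge (A : set S) (f : LF) (x : X) :
  measurable A -> mu A <> 0%E -> {ae mu, forall t, A t -> \val f t = x} ->
  `|x| <= `|\pi_L f|.
Proof.
move=> mA A0 fx.
have : {ae mu, forall t, A t -> `|x| <= `|\pi_L f|}.
  by apply: filterS2 fx (ae_le_Linfty_norm sc mu X f) => t fx ft /fx <-.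
by move=> /(ae_meets mu _ _ mA A0)[t At]; exact.
Qed.

Lemma splice_weakly_open (A : nat -> set S) (mA : forall n, measurable (A n))
    (f g : LF) (U : set L) : trivIset setT A ->
  weakly_open U -> U (\pi_L g) -> exists n, U (\pi_L (splice (mA n) f g)).
Proof.
move=> tA oU Ug.
have : \forall n \near \oo, U (\pi_L (splice (mA n) f g)).
  apply: (weakly_open_cvg L U (\pi_L g)
    ((fun n => \pi_L (splice (mA n) f g)) @ \oo)) => //.
  by move=> phi; exact: splice_weak_cvg.
by case=> n _ /(_ n (leqnn n)) Un; exists n.
Qed.

(** The sequence is arranged as a double sequence: the first index moves a given
    function to a nearby [z] equal to [x] on the whole row [B n], the second one
    moves [z] to functions equal to [- x] on one member of the row. *)
Lemma disjoint_weak_DD2P (A : nat -> set S) : (exists x : X, x != 0) ->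
  (forall n, measurable (A n)) -> trivIset setT A ->
  (forall n, mu (A n) <> 0%E) -> weak_DD2P L.
Proof.
move=> [x0 x0_neq0] mA tA A0.
pose x := `|x0|^-1 *: x0.
have x1 : `|x| = 1 by rewrite normrZ normfV normr_id mulVf// normr_eq0.
pose idx (n m : nat) : nat := pickle (n, m).
have idxI n m n' m' : idx n m = idx n' m' -> n = n' /\ m = m'.
  by move=> /(pcan_inj pickleK)[].
pose B n := \bigcup_m A (idx n m).
have mB n : measurable (B n) by exact: bigcupT_measurable.
have tB : trivIset setT B.
  move=> n n' _ _ [t [[m _ At] [m' _ At']]].
  have /idxI[//] : idx n m = idx n' m' by apply: tA => //; exists t.
have tA' n : trivIset setT (fun m => A (idx n m)).
  move=> m m' _ _ Amm'.
  by have /idxI[] : idx n m = idx n m' by apply: tA.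
move=> W [U oU ->] [w]; elim/quotW: w => f [/= Uf f1].
have [n Uz] := splice_weakly_open B mB (Linfty_cst x) f U tB oU Uf.
set z := splice (mB n) (Linfty_cst x) f in Uz.
have z1 : `|\pi_L z| <= 1.
  apply: splice_norm_le => //.
  by rewrite (le_trans (Linfty_cst_norm _ _ _ _))// x1.
exists (\pi_L z) => // V [U' oU' ->] Vz.
apply/diametral_supP => //; first by exists U'.
have [m Uy] := splice_weakly_open _ (fun m => mA (idx n m))
  (Linfty_cst (- x)) z U' (tA' n) oU' Vz.1.
set y := splice (mA (idx n m)) _ z in Uy.
have y1 : `|\pi_L y| <= 1.
  apply: splice_norm_le => //.
  by rewrite (le_trans (Linfty_cst_norm _ _ _ _))// normrN x1.
move=> c /(_ _ (ex_intro2 _ _ (\pi_L y) (conj Uy y1) erefl)); apply: le_trans.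
rewrite -raddfB.
have -> : 2 = `|x + x|.
  by rewrite -[x + x]mulr2n normrMn x1.
apply: (Linfty_norm_ge (A (idx n m))) => //.
apply: nearW => t At; rewrite val_LinftyB.
rewrite /y splice_in// /z splice_in; last by exists m.
by rewrite !SubK opprK.
Qed.

End disjoint_weak_DD2P.

(** * Atoms *)

Lemma norm_le_continuous {K : numFieldType} {Y Z : normedModType K}
    (T : {linear Y -> Z}) : (forall y, `|T y| <= `|y|) -> continuous T.
Proof.
move=> T1; apply/linear_bounded_continuous/linear_boundedP.
apply: filterS (nbhs_pinfty_ge (real1 K)) => r r1 y.
by apply: le_trans (T1 y) _; exact: ler_peMl.
Qed.

Section atoms.
Context {R : realType} {K : numFieldType} (sc : scalar_field R K)
  {d : measure_display} {S : measurableType d}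
  (mu : {measure set S -> \bar R}) (X : normedModType K).
Local Notation L := (Linfty sc mu X).
Local Notation LF := (Linfty_fun mu X).
Local Notation splice := (splice mu X).
Local Notation Linfty_cst := (Linfty_cst mu X).

(** Finitely many level sets cover the atom, so one of them meets it in positive
    measure, and then covers it up to a null set. *)
Lemma simple_function_atom (A : set S) (g : S -> X) : atom mu A ->
  simple_function g -> exists x, {ae mu, forall t, A t -> g t = x}.
Proof.
move=> [mA A0 aA] [Fg mg].
have [x x0] : exists x, mu (A `&` g @^-1` [set x]) <> 0%E.
  apply: contrapT => /forallNP nx.
  suff : mu A = 0%E by move/eqP; rewrite gt_eqF.
  apply: measure_negligible => //.
  have /finite_seqP[s sE] := Fg.
  have gs t : g t \in s.
    by have : [set` s] (g t) by rewrite -sE; exists t.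
  suff : mu.-negligible (\bigcup_n (A `&` g @^-1` [set nth 0 s n])).
    apply: negligibleS => t At; exists (index (g t) s) => //; split => //=.
    by rewrite nth_index.
  apply: negligible_bigcup => n; apply/negligibleP; first exact: measurableI.
  by apply: contrapT; exact: nx.
exists x.
have [//|Ax0] := aA _ (measurableI _ _ mA (mg x)) (@subIsetl _ _ _).
exists (A `\` (A `&` g @^-1` [set x])); split => //.
  by apply: measurableD => //; exact: measurableI.
by move=> t /= /not_implyP[At gt]; split=> // -[].
Qed.

(** The constants of an approximating sequence converge at almost every point of
    the atom to the value there, and limits are unique. *)
Lemma strongly_measurable_atom (A : set S) (f : S -> X) : atom mu A ->
  strongly_measurable mu f -> exists x, {ae mu, forall t, A t -> f t = x}.
Proof.
move=> aA [g [sg gf]]; have [mA A0 _] := aA.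
have [x xg] := choice (fun n => simple_function_atom A (g n) aA (sg n)).
have {}xg : {ae mu, forall t, A t -> x @ \oo --> f t}.
  have := ae_foralln xg; apply: filterS2 gf => t gt xgt At.
  by rewrite (_ : x = g ^~ t)//; apply/funext => n; rewrite xgt.
have A0' : mu A <> 0%E by apply/eqP; rewrite gt_eqF.
have [t0 At0 /(_ At0) xt0] := ae_meets mu A _ mA A0' xg.
exists (f t0); apply: filterS xg => t xt /xt {}xt.
exact: (cvg_unique _ xt xt0).
Qed.

Section evaluation.
Context (A : set S) (aA : atom mu A).

Let A_neq0 : mu A <> 0%E.
Proof. by have [_ + _] := aA; move=> A0; apply/eqP; rewrite gt_eqF. Qed.

Let mA : measurable A. Proof. by have [] := aA. Qed.

Let value_ex (f : LF) : exists x, {ae mu, forall t, A t -> \val f t = x}.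
Proof.
by have /Linfty_predP[mf _] := valP f; exact: strongly_measurable_atom.
Qed.

Definition atom_value (u : L) : X := sval (cid (value_ex (repr u))).

Lemma ae_atom_value (f : LF) :
  {ae mu, forall t, A t -> \val f t = atom_value (\pi_L f)}.
Proof.
have /Linfty_eqP : \pi_L (repr (\pi_L f)) = \pi_L f by rewrite reprK.
apply: filterS2 (svalP (cid (value_ex (repr (\pi_L f))))) => t ft <-.
exact: ft.
Qed.

Lemma atom_value_eq (f : LF) (x : X) :
  {ae mu, forall t, A t -> \val f t = x} -> atom_value (\pi_L f) = x.
Proof.
move=> fx; have fxv : {ae mu, forall t, A t -> atom_value (\pi_L f) = x}.
  by apply: filterS2 fx (ae_atom_value f) => t fx fv At; rewrite -fv// fx.
by have [t At] := ae_meets mu A _ mA A_neq0 fxv; exact.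
Qed.

Lemma atom_value_linear : linear atom_value.
Proof.
move=> a; elim/quotW => f; elim/quotW => g.
rewrite -Linfty_piZ -raddfD; apply: atom_value_eq.
apply: filterS2 (ae_atom_value f) (ae_atom_value g) => t ft gt At.
by rewrite val_LinftyD val_LinftyZ ft// gt.
Qed.

HB.instance Definition _ :=
  GRing.isLinear.Build K L X *:%R atom_value atom_value_linear.

Lemma atom_value_norm (u : L) : `|atom_value u| <= `|u|.
Proof.
elim/quotW: u => f; apply: (Linfty_norm_ge sc mu X A) => //.
exact: ae_atom_value.
Qed.

Lemma atom_value_continuous : continuous atom_value.
Proof. by apply: norm_le_continuous; exact: atom_value_norm. Qed.

Definition atom_embed (x : X) : L := \pi_L (splice mA (Linfty_cst x) 0).

Lemma atom_embed_linear : linear atom_embed.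
Proof.
move=> a x y.
rewrite /atom_embed -Linfty_piZ -raddfD.
congr (\pi_L _); apply: val_inj; apply/funext => t.
rewrite val_LinftyD val_LinftyZ.
have [At|At] := pselect (A t); first by rewrite !splice_in.
by rewrite !splice_out// scaler0 addr0.
Qed.

HB.instance Definition _ :=
  GRing.isLinear.Build K X L *:%R atom_embed atom_embed_linear.

Lemma atom_embed_continuous : continuous atom_embed.
Proof.
apply: norm_le_continuous => x.
apply: splice_norm_le; first exact: Linfty_cst_norm.
by rewrite raddf0 normr0.
Qed.

(** Only the value on the atom is varied: [T x] is [f] overwritten by [x], a
    continuous affine function of [x] that does not decrease distances and, as
    [f] has norm at most 1, maps the unit ball to the unit ball. *)
Lemma weak_DD2P_Linfty_of_atom : weak_DD2P X -> weak_DD2P L.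
Proof.
move=> DX W [U oU ->] [w]; elim/quotW: w => f [/= Uf f1].
pose T (x : X) : L := \pi_L (splice mA (Linfty_cst x) f).
have TE x : T x = \pi_L (splice mA 0 f) + atom_embed x.
  rewrite /T /atom_embed -raddfD; congr (\pi_L _).
  apply: val_inj; apply/funext => t; rewrite val_LinftyD.
  have [At|At] := pselect (A t); first by rewrite !splice_in// add0r.
  by rewrite !splice_out// addr0.
have oT (V : set L) : weakly_open V -> weakly_open (T @^-1` V).
  move=> oV; rewrite (_ : T = fun x => \pi_L (splice mA 0 f) + atom_embed x).
    by apply: weakly_open_preimage_affine => //; exact: atom_embed_continuous.
  by apply/funext.
have T1 x : `|x| <= 1 -> `|T x| <= 1.
  move=> x1; apply: splice_norm_le => //.
  exact: le_trans (Linfty_cst_norm _ _ _ _) x1.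
pose x0 := atom_value (\pi_L f).
have Tx0 : T x0 = \pi_L f.
  apply/Linfty_eqP; apply: filterS (ae_atom_value f) => t ft.
  have [At|At] := pselect (A t); last by rewrite splice_out.
  by rewrite splice_in// ft.
have [||z [/= Uz z1] Dz] := DX ((T @^-1` U) `&` @closed_unit_ball K X).
- by exists (T @^-1` U) => //; exact: oT.
- exists x0; split; rewrite /= ?Tx0//.
  by apply: le_trans (atom_value_norm _) f1.
exists (T z); first by split => //; exact: T1.
move=> V [U' oU' ->] Vz; apply/diametral_supP => //; first by exists U'.
move=> c cub.
have oV : relatively_weakly_open ((T @^-1` U') `&` @closed_unit_ball K X).
  by exists (T @^-1` U') => //; exact: oT.
have Vz' : ((T @^-1` U') `&` @closed_unit_ball K X) z by split => //; case: Vz.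
have /diametral_supP := Dz _ oV Vz'; apply => // _ [y [/= Uy y1] <-].
have : `|T z - T y| <= c.
  by apply: cub; exists (T y) => //; split=> //; exact: T1.
apply: le_trans; rewrite -raddfB; apply: (Linfty_norm_ge sc mu X A) => //.
by apply: nearW => t At; rewrite val_LinftyB !splice_in.
Qed.

End evaluation.

(** A complement of positive measure would contain an atom; its class is that of
    a chosen atom disjoint from it, so it would be null. *)
Lemma finitely_many_atoms_cover :
  purely_atomic mu -> ~ infinitely_many_atoms mu ->
  exists n (A : 'I_n -> set S), (forall i, atom mu (A i)) /\
    mu.-negligible (~` \bigcup_i A i).
Proof.
move=> pa /contrapT/finite_seqP[s sE].
have sA (i : 'I_(size s)) :
    exists A, atom mu A /\ atom_class mu A = nth set0 s i.
  have : [set` s] (nth set0 s i) by rewrite /= mem_nth.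
  by rewrite -sE => -[A aA <-]; exists A.
have [A /all_and2[aA Ai]] := choice sA.
exists (size s), A; split => //.
have mC : measurable (~` \bigcup_i A i).
  apply: measurableC; apply: fin_bigcup_measurable => // i _.
  by have [] := aA i.
apply/negligibleP => //; apply: contrapT => C0.
have [|B aB BC] := pa _ mC.
  by rewrite lt0e; apply/andP; split=> //; apply/eqP.
have : [set` s] (atom_class mu B) by rewrite -sE; exists B.
move=> /= /[dup] Bs; rewrite -index_mem => Bi.
have : atom_class mu (A (Ordinal Bi)) B.
  by rewrite Ai/= nth_index//; split => //; rewrite setYK measure0.
have [mB + _] := aB => + [_ AB0]; apply/negP; rewrite -leNgt measure_le0.
apply/eqP.
have mA := aA (Ordinal Bi); have {}mA : measurable (A (Ordinal Bi)) by case: mA.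
apply: subset_measure0 AB0 => //.
  by apply: measurableU; exact: measurableD.
by move=> t Bt; right; split=> // At; apply: (BC t Bt); exists (Ordinal Bi).
Qed.

(** If [X] fails the property because of [W], then so does [L_oo(mu, X)] because
    of the functions whose values all lie in [W]: finitely many bounds less than
    2 have a maximum less than 2. *)
Lemma weak_DD2P_of_Linfty (n : nat) (A : 'I_n -> set S) :
  (forall i, atom mu (A i)) -> mu.-negligible (~` \bigcup_i A i) ->
  weak_DD2P L -> weak_DD2P X.
Proof.
move=> aA cA DL W [U oU ->] [w [/= Uw w1]]; apply: contrapT => nW.
pose T i : {linear L -> X} := atom_value _ (aA i).
have oT (V : 'I_n -> set X) : (forall i, weakly_open (V i)) ->
    relatively_weakly_open
      ([set u | forall i, V i (T i u)] `&` @closed_unit_ball K L).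
  move=> oV; exists [set u | forall i, V i (T i u)] => //.
  rewrite /weakly_open openE => u /= Vu.
  apply: (@filter_forall _ _ (fun i u => V i (T i u))
    (nbhs (u : weak_topological L))) => i.
  apply: (@open_nbhs_nbhs (weak_topological L)); split => //=.
  have := weakly_open_preimage_affine _ _ (T i) 0 (V i)
    (atom_value_continuous _ (aA i)) (oV i).
  by congr (weakly_open _); apply/funext => v /=; rewrite add0r.
have [|z [/= Uz z1] Dz] := DL _ (oT (fun=> U) (fun=> oU)).
  exists (\pi_L (Linfty_cst w)); split => /=.
    by move=> i; rewrite /T/= (atom_value_eq _ _ _ w)//; apply: nearW.
  exact: le_trans (Linfty_cst_norm _ _ _ _) w1.
have Tz1 i : `|T i z| <= 1 by apply: le_trans z1; exact: atom_value_norm.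
have bad i : exists Vc : set X * K, [/\ weakly_open Vc.1, Vc.1 (T i z),
    ubound [set `|T i z - y| | y in Vc.1 `&` @closed_unit_ball K X] Vc.2 &
    ~ 2 <= Vc.2].
  apply: contrapT => nV; apply: nW; exists (T i z).
    by split; [exact: Uz|exact: Tz1].
  move=> V rV Vz.
  apply/diametral_supP => // c cub; case: rV Vz cub => V' oV' -> [V'z _] cub.
  by apply: contrapT => c2; apply: nV; exists (V', c).
have [Vc /all_and4[oV Vz Vub Vlt]] := choice bad.
(* The maximum is taken in [R], since complex scalars are only partially
   ordered. *)
pose M := \big[Num.max/0]_(i < n) re sc (Vc i).2.
have c0 i : 0 <= (Vc i).2.
  apply: (Vub i); exists (T i z); last by rewrite subrr normr0.
  by split; [exact: Vz|exact: Tz1].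
have M0 : 0 <= of_real sc M.
  by rewrite -(of_real0 sc) ler_of_real; exact: bigmax_ge_id.
have two : 2 = of_real sc 2 by rewrite (of_real_nat sc 2).
have : 2 <= of_real sc M.
  apply: (diametral_supP _ z (oT _ oV) (conj Vz z1)).1.
    exact: Dz (oT _ oV) (conj Vz z1).
  move=> _ [u [/= Vu u1] <-].
  have TzuM i : `|T i z - T i u| <= of_real sc M.
    have /le_trans : `|T i z - T i u| <= (Vc i).2.
      apply: Vub; exists (T i u) => //; split=> //=.
      exact: le_trans (atom_value_norm _ _ _) u1.
    by apply; rewrite -(ge0_reK sc (c0 i)) ler_of_real; exact: le_bigmax.
  have {}TzuM i : `|T i (z - u)| <= of_real sc M by rewrite linearB.
  move: (z - u) TzuM; elim/quotW => f fM; apply: Linfty_norm_le => //.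
  have af : {ae mu, forall t, forall i, A i t -> \val f t = T i (\pi_L f)}.
    by apply: filter_forall => i; exact: ae_atom_value.
  have {}cA : {ae mu, forall t, (\bigcup_i A i) t} by [].
  by apply: filterS2 cA af => t [i _ At] /(_ i At) ->.
apply/negP; rewrite two ler_of_real -ltNge.
apply: bigmax_lt => // i _.
by rewrite ltNge -(ler_of_real sc) -two ge0_reK//; apply/negP.
Qed.

End atoms.

Local Close Scope quotient_scope.

Theorem theorem4p3 (R : realType) (K : numFieldType) (sc : scalar_field R K)
    (d : measure_display) (S : measurableType d)
    (mu : {measure set S -> \bar R}) (X : completeNormedModType K)
    (mu_neq0 : (0 < mu [set: S])%E) (X_neq0 : exists x : X, x != 0) :
  weak_DD2P (Linfty sc mu X) <->
  [\/ ~ purely_atomic mu, infinitely_many_atoms mu | weak_DD2P X].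
Proof.
split=> [DL|].
  have [pa|] := pselect (purely_atomic mu); last by constructor 1.
  have [|fin] := pselect (infinitely_many_atoms mu); first by constructor 2.
  constructor 3.
  have [n [A [aA cA]]] := finitely_many_atoms_cover mu pa fin.
  exact: (weak_DD2P_of_Linfty sc mu X n A aA cA DL).
case=> [npa|inf|DX].
- have [A [mA tA A0]] := not_purely_atomic_disjoint mu npa.
  exact: (disjoint_weak_DD2P sc mu X A X_neq0 mA tA A0).
- have [A [mA tA A0]] := infinitely_many_atoms_disjoint mu inf.
  exact: (disjoint_weak_DD2P sc mu X A X_neq0 mA tA A0).
have [pa|npa] := pselect (purely_atomic mu).
  have [A aA _] := pa _ measurableT mu_neq0.
  exact: (weak_DD2P_Linfty_of_atom sc mu X A aA DX).
have [A [mA tA A0]] := not_purely_atomic_disjoint mu npa.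
exact: (disjoint_weak_DD2P sc mu X A X_neq0 mA tA A0).
Qed.
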